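(* Suppose that $A+zB$ is an $n\times n$ regular complex pencil having eigenvalues $\lambda_1,\lambda_2,\dots,\lambda_n$ (possibly with repetitions and possibly equal to $\infty$). For every permutation $\sigma$ of $\{1,\dots,n\}$, there exist unitary matrices $Q$ and $Z$ such that 1. $Q(A+zB)Z$ is in Schur form, i.e. $QAZ$ and $QBZ$ are both upper triangular, and 2. the diagonal elements $[Q(A+zB)Z]_{ii}=:t_{ii}-zs_{ii}$ satisfy $\dfrac{t_{ii}}{s_{ii}}=\lambda_{\sigma(i)}$ for all $i=1,\dots,n$.
   Context: A square pencil $A+zB$ is regular if $\det(A+zB)$ is not identically zero as a polynomial in $z$. Its eigenvalues are the elements $\mu\in\mathbb{C}\cup\{\infty\}$ such that $\operatorname{rank}(A+\mu B)<n$ (with the convention $A+\infty B:=B$), listed with algebraic multiplicity: the finite ones are the roots of $\det(A+zB)$ with multiplicity, and $\infty$ is counted with multiplicity $n-\deg\det(A+zB)$. Ratios are understood as elements of $\mathbb{C}\cup\{\infty\}$, with $t/0=\infty$ for $t\neq 0$. *)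

(* Defs.v *)
From HB Require Import structures.
From mathcomp Require Import all_boot all_order all_algebra.
From mathcomp Require Import spectral complex reals.

Set Implicit Arguments.
Unset Strict Implicit.
Unset Printing Implicit Defensive.

Import GRing.Theory.
Local Open Scope ring_scope.

Section Pencils.
Variables (C : fieldType) (n : nat).
Implicit Types (A B : 'M[C]_n) (mu : option C).

Definition pencil A B : 'M[{poly C}]_n :=
  map_mx polyC A + 'X *: map_mx polyC B.

Definition regular_pencil A B : bool := \det (pencil A B) != 0.

(* Throughout, [option C] stands for C together with a point at infinity:
   [Some m] is the finite number m and [None] is infinity. *)
Definition pencil_at A B mu : 'M[C]_n :=
  if mu is Some m then A + m *: B else B.

Definition pencil_eigenvalue A B mu : bool := (\rank (pencil_at A B mu) < n)%N.

(* Only meant for regular pencils, for which the determinant is nonzero, so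
   that [(size _).-1] is its degree and [mup] the multiplicity of a root. *)
Definition alg_mult A B mu : nat :=
  if mu is Some m then mup m (\det (pencil A B))
  else (n - (size (\det (pencil A B))).-1)%N.

Definition eigenvalue_listing A B (lambda : 'I_n -> option C) : Prop :=
  (forall mu, pencil_eigenvalue A B mu <-> exists i, lambda i = mu)
  /\ (forall mu, pencil_eigenvalue A B mu ->
        #|[set i | lambda i == mu]| = alg_mult A B mu).

(* t / s = mu in C together with infinity. The ratio 0 / 0 is undefined: it is
   equal to no mu. *)
Definition ratio_eq (t s : C) mu : Prop :=
  if mu is Some m then s != 0 /\ t / s = m else s = 0 /\ t != 0.

Definition upper_triangular A : Prop :=
  forall i j : 'I_n, (j < i)%N -> A i j = 0.

End Pencils.

(* Main.v *)
Require Import Defs.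
From HB Require Import structures.
From mathcomp Require Import all_boot all_order all_algebra all_fingroup.
From mathcomp Require Import spectral complex reals.

(** The generalized Schur form is obtained by deflating one eigenvalue at a
    time; since any remaining eigenvalue may be chosen at each step, the
    eigenvalues come out on the diagonal in any prescribed order.

    A point mu of the projective line is represented by the linear form
    [linear_factor mu], which is X - m at a finite m and the constant 1 at
    infinity. With this convention a family lambda of n points lists the
    eigenvalues of an n x n regular pencil as soon as
    det (A + X B) and the product of the linear factors of the lambda i agree
    up to a nonzero scalar ([eigenvalue_listing_det]): the finite multiplicities
    determine the determinant up to a scalar, and infinity accounts for the
    indices left over. This form of the hypothesis does not depend on the order
    of the family, and is inherited by quotients because factors cancel.

    Given an eigenvalue mu = lambda 0, there is v <> 0 such that A v and B v are
    multiples a w and b w of a single vector w, where a + b X is the linear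
    factor of mu ([deflating_vector]). If Z is unitary with first column along
    v, and Q is unitary with Q w along the first basis vector, then
    QAZ and QBZ are block upper triangular, with upper left entries k a and k b
    for a common scalar k ([unitary_deflation]). Taking determinants and
    cancelling the factor of mu shows that k is nonzero and that the lower right
    blocks form a pencil whose eigenvalues are the remaining lambda i, so that
    induction applies ([ordered_schur]). *)

Set Implicit Arguments.
Unset Strict Implicit.
Unset Printing Implicit Defensive.

Import GRing.Theory.
Local Open Scope ring_scope.
Local Open Scope complex_scope.

(** * Root multiplicities *)

Lemma mup_prod (F : fieldType) (I : Type) (r : seq I) (p : I -> {poly F})
    (x : F) :
  (forall i, p i != 0) ->
  mup x (\prod_(i <- r) p i) = (\sum_(i <- r) mup x (p i))%N.
Proof.
move=> p_neq0; elim: r => [|i r IHr].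
  by rewrite !big_nil mupNroot // root1.
rewrite !big_cons mupM ?IHr //.
by elim/big_ind: _ => [|? ? | i0 _]; rewrite ?oner_neq0 //; exact: mulf_neq0.
Qed.

Lemma mup_XsubC (F : fieldType) (x y : F) : mup x ('X - y%:P) = (y == x).
Proof.
by rewrite -[_ - _]expr1 mup_XsubCX eq_sym; case: eqP.
Qed.

(** Over a closed field, both polynomials split, and their multisets of roots
    are read off from the multiplicities. *)
Lemma eqp_mup (F : closedFieldType) (p q : {poly F}) :
  p != 0 -> q != 0 -> (forall x, mup x p = mup x q) -> p %= q.
Proof.
have mup_roots (c : F) r x : c != 0 ->
    mup x (c *: \prod_(z <- r) ('X - z%:P)) = count_mem x r.
  move=> c_neq0; rewrite -mul_polyC mupMr; last by rewrite rootC.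
  rewrite mup_prod => [|z]; last by rewrite polyXsubC_eq0.
  rewrite -sum1_count [RHS]big_mkcond; apply: eq_bigr => z _.
  by rewrite mup_XsubC /=; case: eqP.
have [r ->] := closed_field_poly_normal p.
have [s ->] := closed_field_poly_normal q.
move: (lead_coef p) (lead_coef q) => {p q} c d.
rewrite !scaler_eq0 !negb_or => /andP[c_neq0 _] /andP[d_neq0 _] eq_mup.
apply: eqp_trans (eqp_scale _ c_neq0) _.
rewrite eqp_sym; apply: eqp_trans (eqp_scale _ d_neq0) _.
suff eq_rs : perm_eq r s by rewrite (perm_big _ eq_rs) eqpxx.
apply/allP => x _; apply/eqP => /=.
by rewrite -(mup_roots c r) // eq_mup mup_roots.
Qed.

(** * Linear factors of points at finite distance or at infinity *)

(** Homogeneous coordinates [(a, b)] of the linear form [a + b X]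
    vanishing at a point of the projective line. *)
Definition factor_coords (F : fieldType) (mu : option F) : F * F :=
  if mu is Some m then (- m, 1) else (1, 0).

Definition linear_factor (F : fieldType) (mu : option F) : {poly F} :=
  (factor_coords mu).1%:P + 'X * (factor_coords mu).2%:P.

Lemma linear_factor_finite (F : fieldType) (m : F) :
  linear_factor (Some m) = 'X - m%:P.
Proof. by rewrite /linear_factor /= mulr1 addrC polyCN. Qed.

Lemma linear_factor_infty (F : fieldType) : linear_factor (@None F) = 1.
Proof. by rewrite /linear_factor /= mulr0 addr0. Qed.

Lemma linear_factor_neq0 (F : fieldType) (mu : option F) :
  linear_factor mu != 0.
Proof.
case: mu => [m|]; first by rewrite linear_factor_finite polyXsubC_eq0.
by rewrite linear_factor_infty oner_eq0.
Qed.

Lemma mup_linear_factor (F : fieldType) (mu : option F) (x : F) :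
  mup x (linear_factor mu) = (mu == Some x).
Proof.
case: mu => [m|]; first by rewrite linear_factor_finite mup_XsubC.
by rewrite linear_factor_infty mupNroot // root1.
Qed.

Lemma size_linear_factor (F : fieldType) (mu : option F) :
  size (linear_factor mu) = (mu != None).+1.
Proof.
case: mu => [m|]; first by rewrite linear_factor_finite size_XsubC.
by rewrite linear_factor_infty size_poly1.
Qed.

Lemma prod_linear_factor_neq0 (F : fieldType) (n : nat)
    (lambda : 'I_n -> option F) :
  \prod_i linear_factor (lambda i) != 0.
Proof. by apply/prodf_neq0 => i _; apply: linear_factor_neq0. Qed.

Lemma size_prod_linear_factor (F : fieldType) (n : nat)
    (lambda : 'I_n -> option F) :
  (size (\prod_i linear_factor (lambda i))%R <= n.+1)%N.
Proof.
apply: leq_trans (size_poly_prod_leq _ _) _.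
rewrite leq_subLR card_ord addnS ltnS addnn -muln2.
rewrite -[n in (n * 2)%N]card_ord -sum_nat_const.
by apply: leq_sum => i _; rewrite size_linear_factor; case: eqP.
Qed.

(** * Determinants of pencils *)

Lemma horner_det_pencil (F : fieldType) (n : nat) (A B : 'M[F]_n) (m : F) :
  (\det (pencil A B)).[m] = \det (A + m *: B).
Proof.
rewrite -horner_evalE -det_map_mx; congr (\det _).
by apply/matrixP => i j; rewrite !mxE /= /horner_eval !hornerE.
Qed.

Lemma pencil_eigenvalue_det (F : fieldType) (n : nat) (A B : 'M[F]_n)
    (mu : option F) :
  pencil_eigenvalue A B mu = (\det (pencil_at A B mu) == 0).
Proof.
rewrite /pencil_eigenvalue -[_ == 0]negbK -unitfE -unitmxE -row_free_unit.
by rewrite /row_free ltn_neqAle rank_leq_row andbT.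
Qed.

Lemma pencil_mul (F : fieldType) (n : nat) (Q A B Z : 'M[F]_n) :
  map_mx polyC Q *m pencil A B *m map_mx polyC Z =
  pencil (Q *m A *m Z) (Q *m B *m Z).
Proof.
by rewrite /pencil mulmxDr mulmxDl -scalemxAr -scalemxAl !map_mxM.
Qed.

Lemma det_pencil_equiv (F : fieldType) (n : nat) (Q A B Z : 'M[F]_n) :
  Q \in unitmx -> Z \in unitmx ->
  \det (pencil (Q *m A *m Z) (Q *m B *m Z)) %= \det (pencil A B).
Proof.
rewrite !unitmxE !unitfE => Q_neq0 Z_neq0.
rewrite -pencil_mul !det_mulmx !det_map_mx mulrC mulrA -polyCM mul_polyC.
by rewrite eqp_scale // mulf_neq0.
Qed.

(** When B is invertible, A + X B is B times the characteristic matrix of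
    - B^-1 A, so its determinant has full degree n. Hence a determinant of
    lower degree reveals an eigenvalue at infinity. *)
Lemma det_lead_pencil_eq0 (F : fieldType) (n : nat) (A B : 'M[F]_n) :
  (size (\det (pencil A B)) <= n)%N -> \det B = 0.
Proof.
apply: contraTeq; rewrite -unitfE -unitmxE -ltnNge => B_unit.
have -> : pencil A B = map_mx polyC B *m char_poly_mx (- (invmx B *m A)).
  rewrite /char_poly_mx map_mxN opprK mulmxDr addrC mul_mx_scalar.
  by rewrite map_mxM mulmxA -map_mxM mulmxV // map_mx1 mul1mx.
rewrite det_mulmx det_map_mx mul_polyC size_scale ?size_char_poly //.
by rewrite -unitfE -unitmxE.
Qed.

(** The multiplicities at finite points determine the determinant up to a
    scalar; the multiplicity at infinity is then forced by the number of
    indices. *)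
Lemma eigenvalue_listing_det (F : closedFieldType) (n : nat) (A B : 'M[F]_n)
    (lambda : 'I_n -> option F) :
  regular_pencil A B -> eigenvalue_listing A B lambda ->
  \det (pencil A B) %= \prod_i linear_factor (lambda i).
Proof.
move=> regAB [eig_lambda mult_lambda].
apply: eqp_mup => // [|m]; first exact: prod_linear_factor_neq0.
rewrite mup_prod => [|i]; last exact: linear_factor_neq0.
have -> : (\sum_i mup m (linear_factor (lambda i)) =
           #|[set i | lambda i == Some m]|)%N.
  rewrite -sum1dep_card [RHS]big_mkcond; apply: eq_bigr => i _.
  by rewrite mup_linear_factor; case: eqP.
have [eig_m | not_eig_m] := boolP (pencil_eigenvalue A B (Some m)).
  by rewrite mult_lambda.
rewrite mupNroot; last first.
  by rewrite rootE horner_det_pencil -(pencil_eigenvalue_det A B (Some m)).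
apply/esym/eqP; rewrite cards_eq0 -subset0; apply/subsetP => i.
rewrite !inE => /eqP lambda_i; case/negP: not_eig_m.
by apply/eig_lambda; exists i.
Qed.

Lemma listing_head_eigenvalue (F : fieldType) (n : nat) (A B : 'M[F]_n.+1)
    (lambda : 'I_n.+1 -> option F) :
  \det (pencil A B) %= \prod_i linear_factor (lambda i) ->
  \det (pencil_at A B (lambda 0)) = 0.
Proof.
rewrite big_ord_recl; case lambda0: (lambda 0) => [m|] /= eq_det.
  rewrite -horner_det_pencil; apply/rootP.
  by rewrite (eqp_root eq_det) linear_factor_finite rootM root_XsubC eqxx.
(* A constant first factor leaves a product of degree at most n. *)
apply: (@det_lead_pencil_eq0 _ _ A); rewrite (eqp_size eq_det).
rewrite linear_factor_infty mul1r.
exact: size_prod_linear_factor.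
Qed.

(** * Deflation *)

(** At a finite point m, v lies in the kernel of A + m B and w is B v; at
    infinity, v lies in the kernel of B and w is A v. *)
Lemma deflating_vector (F : fieldType) (n : nat) (A B : 'M[F]_n)
    (mu : option F) :
  \det (pencil_at A B mu) = 0 ->
  exists v w : 'cV[F]_n,
    [/\ v != 0, A *m v = (factor_coords mu).1 *: w &
        B *m v = (factor_coords mu).2 *: w].
Proof.
move=> det0.
have [u u_neq0 uM] :
    exists2 u : 'rV[F]_n, u != 0 & u *m (pencil_at A B mu)^T = 0.
  by apply/det0P; rewrite det_tr det0.
have v_neq0 : u^T != 0 by rewrite trmx_eq0.
have {uM}Mv : pencil_at A B mu *m u^T = 0.
  by apply: trmx_inj; rewrite trmx_mul trmxK uM trmx0.
case: mu {det0} Mv => [m|] /= Mv.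
  exists u^T, (B *m u^T); rewrite scale1r; split=> //.
  by apply/eqP; rewrite scaleNr -addr_eq0 scalemxAl -mulmxDl Mv.
by exists u^T, (A *m u^T); rewrite scale1r scale0r Mv.
Qed.

(** Gram-Schmidt orthonormalization keeps the line of the first row, so it is
    applied to any matrix starting with the transpose of v; here all rows are
    equal. *)
Lemma unitary_col (C : numClosedFieldType) (n : nat) (v : 'cV[C]_n.+1) :
  exists2 U : 'M[C]_n.+1, U \is unitarymx &
    exists c : C, v = c *: col 0 U.
Proof.
pose S := schmidt (\matrix_(i < n.+1) v^T).
exists S^T; first by rewrite trmx_unitary schmidt_unitarymx.
have := row_schmidt_sub (\matrix_(i < n.+1) v^T) 0.
rewrite rowK (big_pred1 0) => [|k]; last by rewrite leqn0.
rewrite genmxE => /sub_rVP[c def_v].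
by exists c; apply: trmx_inj; rewrite linearZ /= tr_col trmxK.
Qed.

(** The first column of Z is along v, which A and B send to a w and b w, and Q
    sends w into the first coordinate axis. The scalar k collects the two
    normalizations, hence is the same for A and B; it is zero when w is. *)
Lemma unitary_deflation (C : numClosedFieldType) (n : nat) (A B : 'M[C]_n.+1)
    (v w : 'cV[C]_n.+1) (a b : C) :
  v != 0 -> A *m v = a *: w -> B *m v = b *: w ->
  exists Q Z : 'M[C]_n.+1,
    [/\ Q \is unitarymx, Z \is unitarymx &
        exists k (rA rB : 'rV[C]_n) (A' B' : 'M[C]_n),
          Q *m A *m Z = block_mx (k * a)%:M rA 0 A' /\
          Q *m B *m Z = block_mx (k * b)%:M rB 0 B'].
Proof.
move=> v_neq0 Av Bv.
have [Z Z_unitary [c def_v]] := unitary_col v.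
have [W W_unitary [d def_w]] := unitary_col w.
have c_neq0 : c != 0.
  by apply: contraNneq v_neq0 => c0; rewrite def_v c0 scale0r.
exists (invmx W), Z; split=> //.
  by rewrite invmx_unitary // trmxC_unitary.
pose k := c^-1 * d.
have deflate (M : 'M[C]_n.+1) (m : C) : M *m v = m *: w ->
    exists (rM : 'rV[C]_n) (M' : 'M[C]_n),
      invmx W *m M *m Z = block_mx (k * m)%:M rM 0 M'.
  move=> Mv; set N := invmx W *m M *m Z.
  have colN : col 0 N = (k * m) *: col 0 1%:M.
    rewrite /N [in LHS]colE -mulmxA -colE.
    have -> : col 0 Z = c^-1 *: v by rewrite def_v scalerA mulVf // scale1r.
    rewrite -scalemxAr -mulmxA Mv def_w scalerA -scalemxAr scalerA.
    rewrite [col 0 W]colE mulmxA mulVmx ?unitarymx_unit // -colE.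
    by congr (_ *: _); rewrite /k -mulrA [d * m]mulrC.
  clearbody N.
  have ulN : ulsubmx (N : 'M_(1 + n)) = (k * m)%:M.
    apply/matrixP => i j; rewrite !ord1 !mxE.
    have /matrixP/(_ 0 0) := colN; rewrite !mxE eqxx mulr1 => <-.
    by congr (fun_of_matrix N _ _); apply: val_inj.
  have dlN : dlsubmx (N : 'M_(1 + n)) = 0.
    apply/matrixP => i j; rewrite !ord1 !mxE.
    have /matrixP/(_ (rshift 1 i) 0) := colN; rewrite !mxE /= mulr0 => <-.
    by congr (fun_of_matrix N _ _); apply: val_inj.
  exists (ursubmx (N : 'M_(1 + n))), (drsubmx (N : 'M_(1 + n))).
  by rewrite -ulN -dlN submxK.
have [rA [A' defA]] := deflate A a Av.
have [rB [B' defB]] := deflate B b Bv.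
by exists k, rA, rB, A', B'.
Qed.

(** * Ordered Schur form *)

Lemma pencil_block (F : fieldType) (n : nat) (a b : F) (rA rB : 'rV[F]_n)
    (A B : 'M[F]_n) :
  pencil (block_mx a%:M rA 0 A : 'M_n.+1) (block_mx b%:M rB 0 B) =
  block_mx (a%:P + 'X * b%:P)%:M (map_mx polyC rA + 'X *: map_mx polyC rB)
    0 (pencil A B).
Proof.
rewrite /pencil !(@map_block_mx _ _ _ 1 n 1 n) (@scale_block_mx _ 1 n 1 n).
rewrite (@add_block_mx _ 1 n 1 n) !map_mx0.
rewrite scaler0 addr0 !map_scalar_mx scale_scalar_mx.
by rewrite -(raddfD (@scalar_mx _ 1)).
Qed.

Lemma upper_triangular_block (F : fieldType) (n : nat) (a : F)
    (r : 'rV[F]_n) (A : 'M[F]_n) :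
  upper_triangular A ->
  upper_triangular (block_mx a%:M r 0 A : 'M_n.+1).
Proof.
move=> triA i j.
case: (@split_ordP 1 n i) => i' ->; case: (@split_ordP 1 n j) => j' ->.
- by rewrite [i']ord1 [j']ord1.
- by rewrite [i']ord1.
- by rewrite (@block_mxEdl _ 1 n 1 n) mxE.
- by rewrite (@block_mxEdr _ 1 n 1 n) ltn_add2l => /triA.
Qed.

Lemma unitary_lift0 (C : numClosedFieldType) (n : nat) (U : 'M[C]_n) :
  U \is unitarymx -> (lift0_mx U : 'M_n.+1) \is unitarymx.
Proof.
move=> /unitarymxP U_unitary; apply/unitarymxP.
rewrite /lift0_mx -idmxE (@tr_block_mx _ 1 n 1 n) (@map_block_mx _ _ _ 1 n 1 n).
rewrite (@mulmx_block _ 1 n 1 n 1 n).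
rewrite !trmx0 !map_mx0 !mulmx0 !mul0mx !addr0 !add0r U_unitary trmx1 map_mx1.
by rewrite mulmx1 -scalar_mx_block.
Qed.

Lemma lift0_mul_block (F : fieldType) (n : nat) (P M Z : 'M[F]_n) (a : F)
    (r : 'rV[F]_n) :
  lift0_mx P *m block_mx a%:M r 0 M *m lift0_mx Z =
  block_mx a%:M (r *m Z) 0 (P *m M *m Z).
Proof.
rewrite /lift0_mx -idmxE !mulmx_block.
by rewrite !(mul0mx, mulmx0, mul1mx, mulmx1, addr0, add0r).
Qed.

(** The scalar k is left free: the entries at i only need to be homogeneous
    coordinates of lambda i, which covers finite and infinite points alike and
    is what [unitary_deflation] provides. *)
Lemma ordered_schur (C : numClosedFieldType) (n : nat) (A B : 'M[C]_n)
    (lambda : 'I_n -> option C) :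
  \det (pencil A B) %= \prod_i linear_factor (lambda i) ->
  exists Q Z : 'M[C]_n,
    [/\ Q \is unitarymx, Z \is unitarymx,
        upper_triangular (Q *m A *m Z), upper_triangular (Q *m B *m Z) &
        forall i, exists k : C, [/\ k != 0,
          (Q *m A *m Z) i i = k * (factor_coords (lambda i)).1 &
          (Q *m B *m Z) i i = k * (factor_coords (lambda i)).2]].
Proof.
elim: n => [|n IHn] in A B lambda *.
  by move=> _; exists 1%:M, 1%:M; split; rewrite ?qualifE ?thinmx0 //; case.
move=> eq_det.
have [v [w [v_neq0 Av Bv]]] :=
  deflating_vector (listing_head_eigenvalue eq_det).
have [Q [Z [Q_unitary Z_unitary]]] := unitary_deflation v_neq0 Av Bv.
case=> k [rA [rB [A' [B' [defA defB]]]]].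
have : \det (pencil (Q *m A *m Z) (Q *m B *m Z)) %=
       \prod_i linear_factor (lambda i).
  by apply: eqp_trans eq_det; apply: det_pencil_equiv; apply: unitarymx_unit.
rewrite defA defB pencil_block (@det_ublock _ 1 n) det_scalar1.
have -> : (k * (factor_coords (lambda 0)).1)%:P
    + 'X * (k * (factor_coords (lambda 0)).2)%:P
    = k%:P * linear_factor (lambda 0).
  by rewrite /linear_factor !polyCM mulrDr [in RHS]mulrCA.
rewrite big_ord_recl -mulrA mul_polyC => eq_det'.
(* If k vanished, so would the determinant of the pencil. *)
have k_neq0 : k != 0.
  apply: contraTneq eq_det' => ->; rewrite scale0r eqp_sym eqp0.
  by rewrite mulf_neq0 ?linear_factor_neq0 ?prod_linear_factor_neq0.
have {}eq_det' : \det (pencil A' B') %=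
    \prod_i linear_factor (lambda (lift 0 i)).
  rewrite -(eqp_mul2l _ _ (linear_factor_neq0 (lambda 0))).
  by apply: eqp_trans eq_det'; rewrite eqp_sym eqp_scale.
have [Q' [Z' [Q'_unitary Z'_unitary triA triB diag]]] := IHn _ _ _ eq_det'.
exists (lift0_mx Q' *m Q), (Z *m lift0_mx Z').
have regroup (M : 'M[C]_n.+1) :
    lift0_mx Q' *m Q *m M *m (Z *m lift0_mx Z') =
    lift0_mx Q' *m (Q *m M *m Z) *m lift0_mx Z' by rewrite !mulmxA.
rewrite !regroup defA defB !lift0_mul_block.
have [unitQ' unitZ'] := (unitary_lift0 Q'_unitary, unitary_lift0 Z'_unitary).
split; try exact: upper_triangular_block.
- exact: mul_unitarymx.
- exact: mul_unitarymx.
move=> i; case: (@split_ordP 1 n i) => j ->.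
  exists k; rewrite [j]ord1 !(@block_mxEul _ 1 n 1 n) !mxE !mulr1n.
  by have -> : lshift n 0 = 0 :> 'I_(1 + n) by apply: val_inj.
have [k' [k'_neq0 diagA diagB]] := diag j; exists k'.
rewrite !(@block_mxEdr _ 1 n 1 n).
by have -> : rshift 1 j = lift 0 j :> 'I_(1 + n) by apply: val_inj.
Qed.

Theorem corollaryA2 (R : realType) (n : nat) (A B : 'M[R[i]]_n)
    (lambda : 'I_n -> option R[i])
    (regAB : regular_pencil A B) (eigAB : eigenvalue_listing A B lambda)
    (sigma : {perm 'I_n}) :
  exists Q Z : 'M[R[i]]_n,
    [/\ Q \is unitarymx, Z \is unitarymx,
        upper_triangular (Q *m A *m Z), upper_triangular (Q *m B *m Z) &
        forall i : 'I_n, exists t s : R[i],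
          (map_mx polyC Q *m pencil A B *m map_mx polyC Z) i i
            = t%:P - 'X * s%:P
          /\ ratio_eq t s (lambda (sigma i))].
Proof.
have eq_det : \det (pencil A B) %= \prod_i linear_factor (lambda (sigma i)).
  apply: eqp_trans (eigenvalue_listing_det regAB eigAB) _.
  by rewrite (reindex_inj (@perm_inj _ sigma)) eqpxx.
have [Q [Z [Q_unitary Z_unitary triA triB diag]]] := ordered_schur eq_det.
exists Q, Z; split=> // i; have [k [k_neq0 diagA diagB]] := diag i.
exists ((Q *m A *m Z) i i), (- (Q *m B *m Z) i i); split.
  by rewrite pencil_mul !mxE polyCN mulrN opprK.
rewrite diagA diagB; case: (lambda (sigma i)) => [m|] /=.
  by rewrite mulr1 oppr_eq0 mulrN invrN mulrNN mulrAC mulfV // mul1r.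
by rewrite mulr0 oppr0 mulr1.
Qed.
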